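(* For every finite group $G$, the pseudo-exponent $\alpha(G)$ satisfies $2<\alpha(G)\le 3$. If $G$ is abelian, then $\alpha(G)=3$.
   Context: For a subset $S$ of a group, $Q(S)=\{s_1s_2^{-1}: s_1,s_2\in S\}$. A group $G$ realizes $\langle n_1,n_2,n_3\rangle$ if there are subsets $S_1,S_2,S_3\subseteq G$ with $|S_i|=n_i$ such that for all $q_i\in Q(S_i)$, if $q_1q_2q_3=1$ then $q_1=q_2=q_3=1$. The pseudo-exponent $\alpha(G)$ of a non-trivial finite group $G$ is the minimum of $\frac{3\log|G|}{\log nmp}$ over all positive integers $n,m,p$ (not all $1$) such that $G$ realizes $\langle n,m,p\rangle$; the pseudo-exponent of the trivial group is $3$. *)

(* Defs.v *)
From mathcomp Require Import all_boot all_order all_algebra all_fingroup.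
From mathcomp Require Import all_classical all_reals all_analysis.

Set Implicit Arguments.
Unset Strict Implicit.
Unset Printing Implicit Defensive.

Import Order.TTheory GRing.Theory Num.Theory.

Local Open Scope ring_scope.

Definition quot_set (gT : finGroupType) (S : {set gT}) : {set gT} :=
  [set (s1 * s2^-1)%g | s1 in S, s2 in S]%SET.

Definition realizes (gT : finGroupType) (G : {group gT}) (n1 n2 n3 : nat) :
    Prop :=
  exists S1 S2 S3 : {set gT},
    [/\ S1 \subset G, S2 \subset G & S3 \subset G] /\
    [/\ #|S1| = n1, #|S2| = n2 & #|S3| = n3] /\
    (forall q1 q2 q3 : gT,
       q1 \in quot_set S1 -> q2 \in quot_set S2 -> q3 \in quot_set S3 ->
       (q1 * q2 * q3 = 1)%g -> [/\ q1 = 1%g, q2 = 1%g & q3 = 1%g]).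

Definition pseudo_exponent_values (R : realType) (gT : finGroupType)
    (G : {group gT}) : set R :=
  [set a : R | exists n m p : nat,
     [/\ (0 < n)%N, (0 < m)%N & (0 < p)%N] /\
     ~ [/\ n = 1%N, m = 1%N & p = 1%N] /\
     realizes G n m p /\
     a = 3 * ln (#|G|%:R : R) / ln ((n * m * p)%:R : R)]%classic.
Arguments pseudo_exponent_values R {gT} G.

(* For a nontrivial group the infimum is a minimum: see pseudo_exponent_min. *)
Definition pseudo_exponent (R : realType) (gT : finGroupType)
    (G : {group gT}) : R :=
  if G :==: 1%g then 3 else inf (pseudo_exponent_values R G).
Arguments pseudo_exponent R {gT} G.

Lemma realizes_11G (gT : finGroupType) (G : {group gT}) :
  realizes G 1 1 #|G|.
Proof.
exists [set 1%g]%SET, [set 1%g]%SET, (G : {set gT}); split.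
  by split; rewrite ?finset.sub1set ?group1.
split; first by rewrite cards1.
move=> q1 q2 q3 /imset2P[x y /set1P-> /set1P-> ->].
move=> /imset2P[x' y' /set1P-> /set1P-> ->] _.
by rewrite invg1 !mulg1 mul1g => ->.
Qed.

Lemma realizes_card_le (gT : finGroupType) (G : {group gT}) (n m p : nat) :
  realizes G n m p -> [/\ (n <= #|G|)%N, (m <= #|G|)%N & (p <= #|G|)%N].
Proof.
move=> [S1 [S2 [S3 [[s1 s2 s3] [[<- <- <-] _]]]]].
by split; apply: subset_leq_card.
Qed.

Lemma pseudo_exponent_min (R : realType) (gT : finGroupType)
    (G : {group gT}) :
  G :!=: 1%g ->
  pseudo_exponent_values R G (pseudo_exponent R G) /\
  (forall a : R, pseudo_exponent_values R G a -> pseudo_exponent R G <= a).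
Proof.
move=> Gn1; set A := pseudo_exponent_values R G.
suff [a [Aa minA]] : exists a, A a /\ forall b, A b -> a <= b.
  have -> : pseudo_exponent R G = a.
    rewrite /pseudo_exponent (negbTE Gn1); apply/eqP.
    rewrite eq_le; apply/andP; split.
      by apply: ge_inf => //; exists a => b; apply: minA.
    by apply: lb_le_inf; [exists a|move=> b; apply: minA].
  by split.
pose I := ('I_(#|G|.+1) * 'I_(#|G|.+1) * 'I_(#|G|.+1))%type.
pose F (i : I) : R :=
  3 * ln (#|G|%:R : R) / ln ((i.1.1 * i.1.2 * i.2)%N%:R : R).
pose P (i : I) := `[< [/\ (0 < i.1.1)%N, (0 < i.1.2)%N & (0 < i.2)%N] /\
  ~ [/\ i.1.1 = 1%N :> nat, i.1.2 = 1%N :> nat & i.2 = 1%N :> nat] /\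
  realizes G i.1.1 i.1.2 i.2 >].
have G1 : (1 < #|G|)%N by rewrite cardG_gt1.
pose i0 : I := (inord 1, inord 1, inord #|G|).
have Pi0 : P i0.
  apply/asboolP; rewrite /= !inordK ?ltnS ?cardG_gt0//.
  split; first by split.
  split; last exact: realizes_11G.
  by case=> _ _ e; rewrite e in G1.
case: (@arg_minP _ _ _ i0 P F Pi0) => i /asboolP[ipos [in1 ireal]] imin.
exists (F i); split; first by exists i.1.1, i.1.2, i.2.
move=> b [n [m [p [pos [n1 [real ->]]]]]].
have [ln_ lm lp] := realizes_card_le real.
pose j : I := (inord n, inord m, inord p).
have := imin j; rewrite /P /F /= !inordK ?ltnS//; apply.
exact/asboolP.
Qed.

(* Main.v *)
(* The triple condition makes (x, y) |-> x^-1 y injective on S1 x S2, so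
   n m <= |G|; if this map is onto G, every quotient of S3 is trivial and p = 1.
   Multiplying the three cyclic instances gives (n m p)^2 < |G|^3 unless
   n = m = p = 1, whence the bound 2.  In an abelian group even
   (x, y, z) |-> x y z is injective on S1 x S2 x S3, so n m p <= |G|, while
   ({1}, {1}, G) always has value 3. *)
Require Import Defs.
From mathcomp Require Import all_boot all_order all_algebra all_fingroup.
From mathcomp Require Import all_classical all_reals all_analysis.
From mathcomp Require Import zify.

Import Order.TTheory GRing.Theory Num.Theory.

Local Open Scope ring_scope.

(** Makes the denominator [ln (n * m * p)] of every candidate value positive, so that it can be
    cleared from inequalities. *)
Lemma muln3_gt1 (n m p : nat) : (0 < n)%N -> (0 < m)%N -> (0 < p)%N ->
  ~ [/\ n = 1%N, m = 1%N & p = 1%N] -> (1 < n * m * p)%N.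
Proof.
move=> n0 m0 p0 n1; rewrite ltn_neqAle eq_sym !muln_gt0 n0 m0 p0 !andbT.
rewrite !muln_eq1; apply/negP => /andP[/andP[/eqP n_1 /eqP m_1] /eqP p_1].
exact: n1.
Qed.

Section Realizes.
Variables (gT : finGroupType) (G : {group gT}).
Implicit Types (x y : gT) (S : {set gT}) (n m p : nat).
Local Open Scope group_scope.

Lemma mem_quot_set S x y : x \in S -> y \in S -> x * y^-1 \in quot_set S.
Proof. by move=> xS yS; apply/imset2P; exists x y. Qed.

Lemma quot_set1 S : (0 < #|S|)%N -> 1 \in quot_set S.
Proof. by case/card_gt0P=> x xS; rewrite -(mulgV x) mem_quot_set. Qed.

Lemma divg_eq1 x y : x * y^-1 = 1 -> x = y.
Proof. by move/eqP; rewrite -eq_mulgV1 => /eqP. Qed.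

(** Conjugation by [q1] turns [q2 * q3 * q1 = 1] into [q1 * q2 * q3 = 1]. *)
Lemma realizes_rot n m p : realizes G n m p -> realizes G m p n.
Proof.
move=> [S1 [S2 [S3 [[s1 s2 s3] [[c1 c2 c3] tpp]]]]].
exists S2, S3, S1; do 2![split; first by []].
move=> q2 q3 q1 q2S q3S q1S /(canRL (mulgK _)); rewrite mul1g => e.
by have [] := tpp q1 q2 q3 q1S q2S q3S; rewrite // -mulgA e mulgV.
Qed.

Lemma ldiv_sub S1 S2 : S1 \subset G -> S2 \subset G ->
  (fun u : gT * gT => u.1^-1 * u.2) @: finset.setX S1 S2 \subset G.
Proof.
move=> s1 s2; apply/fintype.subsetP => _ /imsetP[[x y] /setXP[xS yS] ->] /=.
by rewrite groupM ?groupV ?(fintype.subsetP s1 x) ?(fintype.subsetP s2 y).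
Qed.

(* The triple condition is only used with q3 = 1. *)
Lemma ldiv_inj S1 S2 S3 : (0 < #|S3|)%N ->
  (forall q1 q2 q3, q1 \in quot_set S1 -> q2 \in quot_set S2 ->
     q3 \in quot_set S3 -> q1 * q2 * q3 = 1 -> [/\ q1 = 1, q2 = 1 & q3 = 1]) ->
  {in finset.setX S1 S2 &, injective (fun u : gT * gT => u.1^-1 * u.2)}.
Proof.
move=> S3_gt0 tpp [x y] [x' y'] /setXP[xS yS] /setXP[x'S y'S] /= e.
have := tpp (x' * x^-1) (y * y'^-1) 1.
rewrite !mem_quot_set// quot_set1// mulg1 -mulgA (mulgA x^-1) e mulgK mulgV.
by case=> // /divg_eq1 <- /divg_eq1 <-.
Qed.

Lemma realizes_mul_le n m p :
  (0 < p)%N -> realizes G n m p -> (n * m <= #|G|)%N.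
Proof.
move=> p0 [S1 [S2 [S3 [[s1 s2 _] [[<- <- c3] tpp]]]]].
rewrite -cardsX -(@card_in_imset _ _ (fun u : gT * gT => u.1^-1 * u.2)).
  exact/subset_leq_card/ldiv_sub.
by apply: (ldiv_inj _ _ _ _ tpp); rewrite c3.
Qed.

Lemma realizes_mul_eq n m p :
  (0 < p)%N -> realizes G n m p -> (n * m = #|G|)%N -> p = 1%N.
Proof.
move=> p0 [S1 [S2 [S3 [[s1 s2 s3] [[c1 c2 c3] tpp]]]]] nmG.
pose f (u : gT * gT) := u.1^-1 * u.2.
(* By injectivity the image has [n * m = #|G|] elements, so it fills [G]. *)
have fG : f @: finset.setX S1 S2 = G.
  apply/eqP; rewrite eqEcard ldiv_sub//=.
  rewrite card_in_imset ?cardsX ?c1 ?c2 ?nmG//.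
  by apply: (ldiv_inj _ _ _ _ tpp); rewrite c3.
have : (0 < n * m)%N by rewrite nmG cardG_gt0.
rewrite muln_gt0 -c1 -c2 => /andP[/card_gt0P[x xS] /card_gt0P[y yS]].
apply/eqP; rewrite eqn_leq p0 andbT -c3; apply/card_le1_eqP => z z' zS z'S.
(* Surjectivity writes this element as [x'^-1 * y']; then [(x * x'^-1) * (y' * y^-1) * (z * z'^-1) =
   1], and the triple condition forces [z = z']. *)
have : x^-1 * (z' * z^-1) * y \in f @: finset.setX S1 S2.
  by rewrite fG !groupM ?groupV ?(fintype.subsetP s1 x)
    ?(fintype.subsetP s2 y) ?(fintype.subsetP s3).
case/imsetP=> -[x' y'] /setXP[x'S y'S]; rewrite /f /= => e.
have := tpp (x * x'^-1) (y' * y^-1) (z * z'^-1).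
rewrite !mem_quot_set// -(mulgA x) (mulgA x'^-1) -e.
rewrite !mulgA mulgV mul1g mulgK mulgKV mulgV.
by case=> // _ _ /divg_eq1.
Qed.

Lemma realizes_sqr_lt n m p : (0 < n)%N -> (0 < m)%N -> (0 < p)%N ->
  ~ [/\ n = 1%N, m = 1%N & p = 1%N] -> realizes G n m p ->
  ((n * m * p) ^ 2 < #|G| ^ 3)%N.
Proof.
move=> n0 m0 p0 n1 r1.
have r2 := realizes_rot _ _ _ r1; have r3 := realizes_rot _ _ _ r2.
have le1 := realizes_mul_le _ _ _ p0 r1.
have le2 := realizes_mul_le _ _ _ n0 r2.
have le3 := realizes_mul_le _ _ _ m0 r3.
have -> : ((n * m * p) ^ 2 = n * m * (m * p) * (p * n))%N.
  by lia.
rewrite (_ : #|G| ^ 3 = #|G| * #|G| * #|G|)%N; last by rewrite !expnS muln1 mulnA.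
rewrite ltn_neqAle (leq_mul (leq_mul le1 le2) le3) andbT.
(* Equality would force each of the three pairwise products to be [#|G|], and then [realizes_mul_eq]
   makes the size missing from each product equal to 1. *)
apply/negP => /eqP e; apply: n1.
have g0 : (0 < #|G|)%N by exact: cardG_gt0.
have cube_eq a b c : (b <= #|G|)%N -> (c <= #|G|)%N -> (a <= #|G|)%N ->
    (a * b * c = #|G| * #|G| * #|G|)%N -> a = #|G|.
  move=> bG cG aG abc; apply/eqP; rewrite eqn_leq aG /=.
  rewrite -(leq_pmul2r (m := #|G| * #|G|)) ?muln_gt0 ?g0//.
  by rewrite mulnA -abc -mulnA leq_mul2l leq_mul ?orbT.
split; [apply: realizes_mul_eq r2 _ | apply: realizes_mul_eq r3 _
       | apply: realizes_mul_eq r1 _] => //.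
- by apply: cube_eq le3 le1 le2 _; rewrite -e [LHS]mulnC mulnA.
- by apply: cube_eq le1 le2 le3 _; rewrite -e -[LHS]mulnA [LHS]mulnC.
- exact: cube_eq le2 le3 le1 e.
Qed.

Lemma realizes_abelian_le n m p :
  abelian G -> realizes G n m p -> (n * m * p <= #|G|)%N.
Proof.
move=> /centsP cG [S1 [S2 [S3 [[s1 s2 s3] [[<- <- <-] tpp]]]]].
rewrite -!cardsX -(@card_in_imset _ _ (fun u : gT * gT * gT =>
  u.1.1 * u.1.2 * u.2)).
  apply/subset_leq_card/fintype.subsetP.
  move=> _ /imsetP[[[x y] z] /setXP[/setXP[xS yS] zS] ->] /=.
  by rewrite !groupM ?(fintype.subsetP s1 x) ?(fintype.subsetP s2 y)
    ?(fintype.subsetP s3 z).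
move=> [[x y] z] [[x' y'] z'] /setXP[/setXP[xS yS] zS].
move=> /setXP[/setXP[x'S y'S] z'S] /= e.
(* By commutativity, [x * y * z = x' * y' * z'] regroups into a product of three quotients equal to
   1. *)
have: [/\ x * x'^-1 = 1, y * y'^-1 = 1 & z * z'^-1 = 1].
  apply: tpp; rewrite ?mem_quot_set//.
  have [xG x'G] := (fintype.subsetP s1 _ xS, fintype.subsetP s1 _ x'S).
  have [yG y'G] := (fintype.subsetP s2 _ yS, fintype.subsetP s2 _ y'S).
  have [zG z'G] := (fintype.subsetP s3 _ zS, fintype.subsetP s3 _ z'S).
  have c a b : a \in G -> b \in G -> a * b = b * a by move=> aG bG; apply: cG.
  have -> : x * x'^-1 * (y * y'^-1) = x * y * (x' * y')^-1.
    rewrite invMg -!mulgA; congr (x * _).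
    by rewrite (c x'^-1) ?groupM ?groupV// -!mulgA.
  rewrite mulgA -(mulgA (x * y)) (c _ z) ?groupV ?groupM// mulgA e.
  by rewrite (c _ z') ?groupM// mulgK mulgV.
by case=> /divg_eq1 -> /divg_eq1 -> /divg_eq1 ->.
Qed.

End Realizes.

Lemma pseudo_exponent_le3 (R : realType) (gT : finGroupType) (G : {group gT}) :
  pseudo_exponent R G <= 3.
Proof.
have [G1|Gn1] := eqVneq (G : {set gT}) 1%g.
  by rewrite /pseudo_exponent G1 eqxx.
have gG : (1 < #|G|)%N by rewrite cardG_gt1.
apply: (pseudo_exponent_min R Gn1).2; exists 1%N, 1%N, #|G|.
split; first by split=> //; exact: ltnW.
split; first by case=> _ _ e; rewrite e in gG.
split; first exact: realizes_11G.
by rewrite !mul1n mulfK// gt_eqF// ln_gt0// ltr1n.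
Qed.

Lemma pseudo_exponent_gt2 (R : realType) (gT : finGroupType) (G : {group gT}) :
  2 < pseudo_exponent R G.
Proof.
have [G1|Gn1] := eqVneq (G : {set gT}) 1%g.
  by rewrite /pseudo_exponent G1 eqxx ltr_nat.
(* The infimum is attained, so the strict inequality, checked at a minimizing triple, is not lost in
   a limit. *)
have [[n [m [p [[n0 m0 p0] [n1 [r ->]]]]]] _] := pseudo_exponent_min R Gn1.
have k1 : (1 < n * m * p)%N by exact: muln3_gt1.
(* Clearing the denominator and exponentiating leaves [(n * m * p) ^ 2 < #|G| ^ 3]. *)
rewrite ltr_pdivlMr ?ln_gt0 ?ltr1n// !mulr_natl -!lnXn ?ltr0n ?cardG_gt0//.
  rewrite ltr_ln ?posrE ?exprn_gt0 ?ltr0n ?cardG_gt0// -?natrX ?ltr_nat.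
    exact: realizes_sqr_lt r.
  exact: ltnW.
exact: ltnW.
Qed.

Lemma abelian_pseudo_exponent_ge3 (R : realType) (gT : finGroupType)
  (G : {group gT}) : abelian G -> 3 <= pseudo_exponent R G.
Proof.
move=> abG; have [G1|Gn1] := eqVneq (G : {set gT}) 1%g.
  by rewrite /pseudo_exponent G1 eqxx.
have [[n [m [p [[n0 m0 p0] [n1 [r ->]]]]]] _] := pseudo_exponent_min R Gn1.
have k1 : (1 < n * m * p)%N by exact: muln3_gt1.
(* The factor 3 cancels, leaving [n * m * p <= #|G|] by monotonicity of [ln]. *)
rewrite ler_pdivlMr ?ln_gt0 ?ltr1n// ler_pM2l//.
rewrite ler_ln ?posrE ?ltr0n ?cardG_gt0 ?(ltnW k1)// ler_nat.
exact: realizes_abelian_le abG r.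
Qed.

Theorem lemma3p1 (R : realType) (gT : finGroupType) (G : {group gT}) :
  (2 < pseudo_exponent R G <= 3) /\
  (abelian G -> pseudo_exponent R G = 3).
Proof.
split; first by rewrite pseudo_exponent_gt2 pseudo_exponent_le3.
move=> abG; apply/eqP; rewrite eq_le pseudo_exponent_le3.
exact: abelian_pseudo_exponent_ge3.
Qed.
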